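(* Let $n>2$ be an integer, $q=2^n$, $a_1\in\mathbb{F}_q^{*}$, $a_2,a_3\in\mathbb{F}_{q^2}^{*}$ with $a_1,a_2,a_3$ pairwise different and $a_1+a_2+a_3\neq0$, and let $b\in\mathbb{F}_{q^2}^{*}$. For $i=1,2,3$ let $f_i(x)=\mathrm{Tr}_1^{2n}\!\left(\frac{a_i}{x^{q-1}+b}\right)$ for $x\in\mathbb{F}_{q^2}$, and let $h_3=f_1f_2+f_1f_3+f_2f_3$. Then $h_3$ is bent if one of the following conditions holds: (1) $b=1$, $a_2\in\mathbb{F}_q^{*}$, $a_3\notin\mathbb{F}_q$, and $\mathrm{Tr}_1^n(a_1+a_2)=1$; (2) $b=1$, $a_2\notin\mathbb{F}_q$, $a_3\notin\mathbb{F}_q$, $a_2+a_3\in\mathbb{F}_q$, $\mathrm{Tr}_1^n(a_2+a_3)=0$ and $\mathrm{Tr}_1^{2n}(a_2)=0$; (3) $b\in U\setminus\{1\}$, $\mathrm{Tr}_n^{2n}(a_2\overline{b})=\mathrm{Tr}_n^{2n}(a_3\overline{b})=0$, $\mathrm{Tr}_1^n(a_2\overline{a_2}+a_3\overline{a_3})=1$ and $h_3(0)=0$; (4) $b\in U\setminus\{1\}$, $\mathrm{Tr}_n^{2n}(a_2\overline{b})=0$, $\mathrm{Tr}_n^{2n}(a_3\overline{b})\neq0$, $\mathrm{Tr}_n^{2n}((a_1+a_2+a_3)\overline{b})=0$, $\mathrm{Tr}_1^n(a_2\overline{a_2})=\mathrm{Tr}_1^n((a_1+a_2+a_3)(a_1+\overline{a_2}+\overline{a_3}))$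 and $h_3(0)=0$; (5) $b\in U\setminus\{1\}$, $\mathrm{Tr}_n^{2n}(a_2\overline{b})\neq0$, $\mathrm{Tr}_n^{2n}(a_3\overline{b})\neq0$, $\mathrm{Tr}_n^{2n}((a_1+a_2+a_3)\overline{b})\neq0$ and $h_3(0)=0$; (6) $b\notin U$ and $2(-1)^{h_3(0)}=2(-1)^{u(a_1)u(a_2)+u(a_1)u(a_3)+u(a_2)u(a_3)}+(-1)^{u(a_1+a_2+a_3)}k(a_1+a_2+a_3)-\sum_{i=1}^{3}(-1)^{u(a_i)}k(a_i)$, where $k(x)=\mathcal{K}_n\!\left(\frac{x\overline{x}}{1+b^2\overline{b}^2}\right)$ and $u(x)=\mathrm{Tr}_1^{2n}\!\left(\frac{\overline{x}b}{1+b\overline{b}}\right)$.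
   Context: For $k\mid m$, $\mathrm{Tr}_k^{m}(x)=x+x^{2^k}+\cdots+x^{2^{(m/k-1)k}}$ is the trace from $\mathbb{F}_{2^m}$ to $\mathbb{F}_{2^k}$. For $x\in\mathbb{F}_{q^2}$ write $\overline{x}=x^{q}$. The unit circle is $U=\{\eta\in\mathbb{F}_{q^2}:\eta^{q+1}=1\}$. Division by zero is interpreted with the convention $\frac{1}{0}=0$. The binary Kloosterman sum is $\mathcal{K}_n(a)=\sum_{x\in\mathbb{F}_{2^n}}(-1)^{\mathrm{Tr}_1^n(\frac1x+ax)}$ (with $\frac10=0$). Values in $\mathbb{F}_2$ appearing in exponents of $-1$ are identified with $0,1\in\mathbb{Z}$. A Boolean function $f:\mathbb{F}_{2^{m}}\to\mathbb{F}_2$ is bent if its Walsh transform $W_f(\omega)=\sum_{x\in\mathbb{F}_{2^m}}(-1)^{f(x)+\mathrm{Tr}_1^m(\omega x)}$ satisfies $W_f(\omega)^2=2^m$ for all $\omega\in\mathbb{F}_{2^m}$. *)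

(* Defs.v *)
(* F is an arbitrary finite field of order 2^(2n) = q^2. *)
From HB Require Import structures.
From mathcomp Require Import all_boot all_order all_algebra all_field.
Set Implicit Arguments. Unset Strict Implicit. Unset Printing Implicit Defensive.
Import GRing.Theory Num.Theory.
Local Open Scope ring_scope.

Section Defs.
Variable F : finFieldType.

Definition Tr (k m : nat) (x : F) : F := \sum_(i < m %/ k) x ^+ (2 ^ (i * k)).

Definition conjq (n : nat) (x : F) : F := x ^+ (2 ^ n).

Definition inFq (n : nat) (x : F) : bool := x ^+ (2 ^ n) == x.

Definition inU (n : nat) (x : F) : bool := x ^+ (2 ^ n + 1) == 1.

(* (-1)^y for y in F_2 (viewed inside F): 1 if y = 0, -1 otherwise *)
Definition sgnF (y : F) : int := if y == 0 then 1 else -1.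

(* binary Kloosterman sum K_n(a) = sum_{x in F_{2^n}} (-1)^{Tr_1^n(1/x + a x)}
   (MathComp's 0^-1 = 0 matches the convention 1/0 = 0) *)
Definition kloosterman (n : nat) (a : F) : int :=
  \sum_(x : F | inFq n x) sgnF (Tr 1 n (x^-1 + a * x)).

Definition walsh (m : nat) (f : F -> bool) (w : F) : int :=
  \sum_(x : F) (-1) ^+ (f x (+) (Tr 1 m (w * x) != 0)).

Definition bent (m : nat) (f : F -> bool) : Prop :=
  forall w : F, walsh m f w ^+ 2 = (2 ^ m)%:Z.

End Defs.

(* Main.v *)
Require Import Defs.
From HB Require Import structures.
From mathcomp Require Import all_boot all_order all_algebra all_field.
From mathcomp Require Import ring.
Import GRing.Theory Num.Theory.
Local Open Scope ring_scope.

(** The function [h3] depends on [x] only through [x ^ (q - 1)], so it is constant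
on the punctured lines of the spread of [F] over [F_q]; such a function [g] is
bent as soon as [sum_{z in U} (-1) ^ g z = (-1) ^ g 0].  The identity
[2 (-1) ^ maj(x, y, z) =
  (-1) ^ x + (-1) ^ y + (-1) ^ z - (-1) ^ (x + y + z)]
reduces this to the sums [S a = sum_{z in U} chi (a / (z + b))].  If [b] is in
[U], rescaling gives [b = 1]; then [1 / (z + 1)] runs over the line
[t + cj t = 1] and [S a] is explicit.  Otherwise a Moebius permutation of [U]
turns [S a] into [sum_{z in U} chi (c * z)] up to sign; the same line together
with [t * cj t = t ^ 2 + t] evaluates this as [1 - K_n (c * cj c)]. *)

Section QuadraticExtension.
Set Implicit Arguments.
Unset Strict Implicit.

Variables (F : finFieldType) (n : nat).
Hypotheses (hF : #|F| = (2 ^ (2 * n))%N) (n_gt0 : (0 < n)%N).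

Local Notation q := (2 ^ n)%N.
Local Notation cj := (conjq n).
Local Notation chi x := (sgnF (Tr 1 (2 * n) x)).
Local Notation psi x := (sgnF (Tr 1 n x)).

(** * Characteristic two and the conjugation [x -> x ^ q] *)

Lemma pchar2F : 2%N \in [pchar F].
Proof. exact: card_finPcharP hF isT. Qed.

Lemma two_eq0 : 2%:R = 0 :> F.
Proof. by have /andP[_ /eqP] := pchar2F. Qed.

Lemma addFF (x : F) : x + x = 0.
Proof. exact: addrr_pchar2 pchar2F x. Qed.

Lemma addFK (x y : F) : x + y + y = x.
Proof. by rewrite -addrA addFF addr0. Qed.

Lemma addF_eq0 (x y : F) : (x + y == 0) = (x == y).
Proof. by rewrite -{2}(oppr_pchar2 pchar2F y) addr_eq0. Qed.

Lemma exp2kD k (x y : F) : (x + y) ^+ (2 ^ k) = x ^+ (2 ^ k) + y ^+ (2 ^ k).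
Proof. by rewrite exprDn_pchar // pnatX pnatE // pchar2F. Qed.

Lemma cjD x y : cj (x + y) = cj x + cj y :> F.
Proof. exact: exp2kD. Qed.

Lemma cjM x y : cj (x * y) = cj x * cj y :> F.
Proof. exact: exprMn. Qed.

Lemma cjV x : cj x^-1 = (cj x)^-1 :> F.
Proof. exact: exprVn. Qed.

Lemma cj1 : cj 1 = 1 :> F.
Proof. exact: expr1n. Qed.

Lemma cj0 : cj 0 = 0 :> F.
Proof. by rewrite /conjq expr0n expn_eq0. Qed.

Lemma cjX k x : cj (x ^+ k) = cj x ^+ k :> F.
Proof. by rewrite /conjq -!exprM mulnC. Qed.

Lemma cjK x : cj (cj x) = x :> F.
Proof. by rewrite /conjq -exprM -expnD addnn -mul2n -hF expf_card. Qed.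

Lemma cj_eq0 (x : F) : (cj x == 0) = (x == 0).
Proof. by rewrite /conjq expf_eq0 expn_gt0. Qed.

Definition cjE := (cjK, cjD, cjM, cjV, cj1, cj0).

Lemma inFqP (x : F) : reflect (cj x = x) (inFq n x).
Proof. exact: eqP. Qed.

Lemma inUE (x : F) : inU n x = (x * cj x == 1).
Proof. by rewrite /inU addn1 exprS. Qed.

Lemma inUP (x : F) : reflect (x * cj x = 1) (inU n x).
Proof. by rewrite inUE; exact: eqP. Qed.

Lemma inFq_rel_trace (x : F) : inFq n (x + cj x).
Proof. by apply/inFqP; rewrite !cjE addrC. Qed.

Lemma inFq_rel_norm (x : F) : inFq n (x * cj x).
Proof. by apply/inFqP; rewrite !cjE mulrC. Qed.

(** * Traces and the signs they define *)

Lemma TrE m (x : F) : Tr 1 m x = \sum_(i < m) x ^+ (2 ^ i).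
Proof. by rewrite /Tr divn1; apply: eq_bigr => i _; rewrite muln1. Qed.

Lemma Tr_relE (x : F) : Tr n (2 * n) x = x + cj x.
Proof. by rewrite /Tr mulnK // !big_ord_recl big_ord0 /= mul0n mul1n expr1 addr0. Qed.

Lemma TrD m (x y : F) : Tr 1 m (x + y) = Tr 1 m x + Tr 1 m y.
Proof. by rewrite !TrE -big_split; apply: eq_bigr => i _; exact: exp2kD. Qed.

Lemma Tr0 m : Tr 1 m (0 : F) = 0.
Proof. by apply: (addrI (Tr 1 m 0)); rewrite -TrD !addr0. Qed.

(** Transitivity of the trace: the upper half of the [2 * n] Frobenius powers of [x] consists of the
    powers of [cj x]. *)
Lemma Tr_double (x : F) : Tr 1 (2 * n) x = Tr 1 n (x + cj x).
Proof.
rewrite TrD !TrE mul2n -addnn big_split_ord /=; congr (_ + _).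
by apply: eq_bigr => i _; rewrite expnD exprM.
Qed.

Lemma Tr_cj (x : F) : Tr 1 (2 * n) (cj x) = Tr 1 (2 * n) x.
Proof. by rewrite !Tr_double cjK addrC. Qed.

(** Squaring shifts the summands of the trace by one, so the sum telescopes. *)
Lemma Tr_artin_schreier m (y : F) : Tr 1 m (y ^+ 2 + y) = y ^+ (2 ^ m) + y.
Proof.
elim: m => [|m IHm]; first by rewrite TrE big_ord0 expr1 addFF.
move: IHm; rewrite !TrE big_ord_recr /= => ->.
rewrite exp2kD -exprM -expnS; ring: two_eq0.
Qed.

Lemma Tr_sqr m (x : F) : x ^+ (2 ^ m) = x -> Tr 1 m (x ^+ 2) = Tr 1 m x.
Proof.
by move=> xm; apply/eqP; rewrite -addF_eq0 -TrD Tr_artin_schreier xm addFF.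
Qed.

(** The trace equals its own square, hence is a root of [X * (X + 1)]. *)
Lemma Tr_bool m (x : F) : x ^+ (2 ^ m) = x -> Tr 1 m x = 0 \/ Tr 1 m x = 1.
Proof.
move=> xm; have: Tr 1 m x * (Tr 1 m x + 1) == 0.
  rewrite mulrDr mulr1 addF_eq0 -{3}(Tr_sqr xm) !TrE -expr2.
  apply/eqP; elim/big_rec2: _ => [|i y1 y2 _ <-]; first by rewrite expr0n.
  by rewrite -(expn1 2) exp2kD -!exprM mulnC.
rewrite mulf_eq0 addF_eq0 => /orP[]/eqP ->; by [left | right].
Qed.

Lemma exp_card2 (x : F) : x ^+ (2 ^ (2 * n)) = x.
Proof. by rewrite -hF expf_card. Qed.

Lemma sgnF_add (x y : F) :
  x = 0 \/ x = 1 -> y = 0 \/ y = 1 -> sgnF (x + y) = sgnF x * sgnF y.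
Proof.
by rewrite /sgnF; move=> [] -> [] ->; rewrite ?addr0 ?add0r ?addFF ?eqxx ?oner_eq0.
Qed.

Lemma chiD (x y : F) : chi (x + y) = chi x * chi y.
Proof. by rewrite TrD sgnF_add //; apply/Tr_bool/exp_card2. Qed.

Lemma psiD (x y : F) : inFq n x -> inFq n y -> psi (x + y) = psi x * psi y.
Proof. by move=> /inFqP xq /inFqP yq; rewrite TrD sgnF_add //; apply: Tr_bool. Qed.

Lemma sgnF0 : sgnF (0 : F) = 1.
Proof. by rewrite /sgnF eqxx. Qed.

Lemma sgnF_sqr (x : F) : sgnF x ^+ 2 = 1.
Proof. by rewrite /sgnF; case: ifP. Qed.

Lemma sgnF_majority (x y z : F) :
  x = 0 \/ x = 1 -> y = 0 \/ y = 1 -> z = 0 \/ z = 1 ->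
  2 * sgnF (x * y + x * z + y * z) =
  sgnF x + sgnF y + sgnF z - sgnF (x + y + z).
Proof.
rewrite /sgnF; move=> [] -> [] -> [] ->;
by rewrite ?(mul0r, mulr0, mulr1, addr0, add0r, addFF) ?eqxx ?oner_eq0.
Qed.

(** The trace is a nonzero polynomial function of degree below [#|F|], so some element is not a
    root. *)
Lemma exists_Tr_neq0 : exists x : F, Tr 1 (2 * n) x != 0.
Proof.
apply/existsP; apply: contraT; rewrite negb_exists => /forallP Tr_eq0.
have [m def_m] : exists m, (2 * n = m.+1)%N.
  by exists (2 * n).-1; rewrite prednK // muln_gt0.
pose p : {poly F} := \sum_(i < m.+1) 'X^(2 ^ i).
have p_neq0 : p != 0.
  apply/eqP => /(congr1 (fun r : {poly F} => r`_1)); apply/eqP.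
  (* The coefficient of ['X] is 1: only [i = 0] contributes to it. *)
  rewrite /p coef_sum coef0 big_ord_recl coefXn /= big1 ?addr0 ?oner_eq0 // => i _.
  by rewrite coefXn /= expnS mul2n; case: (2 ^ _)%N.
have p_root : all (root p) (enum F).
  apply/allP => x _; rewrite rootE /p horner_sum.
  under eq_bigr do rewrite hornerXn.
  by have := Tr_eq0 x; rewrite negbK TrE def_m.
have := max_poly_roots p_neq0 p_root (enum_uniq F).
rewrite -cardE hF def_m ltnNge ; apply: contraNT => _.
apply: (leq_trans (size_sum _ _ _)); apply/bigmax_leqP => i _.
rewrite size_polyXn expnS mul2n -addnn -addn1 addnC leq_add ?expn_gt0 //.
by rewrite leq_exp2l // -ltnS.
Qed.

Lemma exists_rel_trace1 : exists t : F, t + cj t = 1.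
Proof.
have [x Tx] := exists_Tr_neq0.
have x_neq0 : x + cj x != 0.
  by apply: contraNneq Tx; rewrite Tr_double => ->; rewrite Tr0.
exists (x / (x + cj x)); rewrite cjM cjV (inFqP _ (inFq_rel_trace x)) -mulrDl.
exact: divff.
Qed.

(** * The subfield of order [q] and character sums over it *)

Lemma inFqD (x y : F) : inFq n x -> inFq n y -> inFq n (x + y).
Proof. by move=> /inFqP xq /inFqP yq; apply/inFqP; rewrite cjD xq yq. Qed.

Lemma inFqM (x y : F) : inFq n x -> inFq n y -> inFq n (x * y).
Proof. by move=> /inFqP xq /inFqP yq; apply/inFqP; rewrite cjM xq yq. Qed.

Lemma inFqV (x : F) : inFq n x -> inFq n x^-1.
Proof. by move=> /inFqP xq; apply/inFqP; rewrite cjV xq. Qed.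

Lemma inFq0 : inFq n (0 : F).
Proof. exact/inFqP/cj0. Qed.

(** If [t] has relative trace 1, then [1, t] is a basis of [F] over the subfield, so the square of
    the cardinal is [q ^ 2]. *)
Lemma card_Fq : #|[set x : F | inFq n x]| = q.
Proof.
have [t Tt] := exists_rel_trace1.
set A := [set x : F | inFq n x]; pose f (p : F * F) := p.1 + t * p.2.
have inj_f : {in setX A A &, injective f}.
  move=> [u v] [u' v']; rewrite !inE /f /= => /andP[/inFqP uq /inFqP vq].
  move=> /andP[/inFqP uq' /inFqP vq'] eq_f.
  (* The relative trace reads off the coordinate along [t]. *)
  have Tf (x y : F) : cj x = x -> cj y = y -> (x + t * y) + cj (x + t * y) = y.
    move=> xq yq; rewrite cjD cjM xq yq -[RHS]mul1r -Tt; ring: two_eq0.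
  have eq_v : v = v' by rewrite -(Tf u v) // eq_f Tf.
  by move: eq_f; rewrite eq_v => /addIr ->.
have im_f : [set f p | p in setX A A] = [set: F].
  apply/setP => x; rewrite inE; apply/imsetP.
  exists (x + t * (x + cj x), x + cj x); last by rewrite /f /= addFK.
  rewrite !inE /= inFq_rel_trace andbT; apply/inFqP; rewrite !cjE.
  have -> : cj t = t + 1 by rewrite -Tt; ring: two_eq0.
  ring: two_eq0.
have /eqP := card_in_imset inj_f.
by rewrite im_f cardsT cardsX hF mulnC expnM mulnn eqn_sqr => /eqP <-.
Qed.

Lemma sum_Fq_const (c : int) : \sum_(y : F | inFq n y) c = q%:Z * c.
Proof.
rewrite (eq_bigl (mem [set y : F | inFq n y])) => [|y]; last by rewrite !inE.
by rewrite sumr_const card_Fq -mulr_natl natz.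
Qed.

Lemma psi_neq1 (c : F) : inFq n c -> c != 0 ->
  exists2 y, inFq n y & psi (c * y) = -1.
Proof.
move=> cq c0; have [x Tx] := exists_Tr_neq0.
exists ((x + cj x) / c); first by rewrite inFqM ?inFqV ?inFq_rel_trace.
by rewrite mulrCA divff // mulr1 -Tr_double /sgnF (negPf Tx).
Qed.

Lemma chi_mulFq (a y : F) : inFq n y -> chi (a * y) = psi ((a + cj a) * y).
Proof. by move=> /inFqP yq; rewrite Tr_double cjM yq mulrDl. Qed.

Lemma inFq_trace0 (a : F) : inFq n a = (a + cj a == 0).
Proof. by rewrite addF_eq0 eq_sym. Qed.

Lemma inFq_Tr_rel (a : F) : inFq n a = (Tr n (2 * n) a == 0).
Proof. by rewrite Tr_relE inFq_trace0. Qed.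

Lemma chi_neq1 (a : F) : ~~ inFq n a -> exists2 y, inFq n y & chi (a * y) = -1.
Proof.
rewrite inFq_trace0 => a0.
have [y yq psiy] := psi_neq1 (inFq_rel_trace a) a0.
by exists y => //; rewrite chi_mulFq.
Qed.

(** Orthogonality argument: translating by a point of sign [-1] makes the sum equal to its
    opposite. *)
Lemma sum_translate_eq0 (P : pred F) (g : F -> int) (y : F) :
    (forall x, P (x + y) = P x) -> (forall x, g (x + y) = - g x) ->
  \sum_(x | P x) g x = 0.
Proof.
move=> Py gy; set S := \sum_(x | P x) g x.
have: S = - S.
  rewrite {1}/S (reindex_inj (addIr y)) /= -sumrN.
  by apply: eq_big => [x|x _]; [exact: Py | exact: gy].
by move/eqP; rewrite -addr_eq0 -mulr2n mulrn_eq0 => /eqP.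
Qed.

Lemma inFqDr (x y : F) : inFq n y -> inFq n (x + y) = inFq n x.
Proof.
move=> yq; apply/idP/idP => xq; last exact: inFqD.
by rewrite -(addFK x y) inFqD.
Qed.

Lemma sum_Fq_chi (a : F) :
  \sum_(y | inFq n y) chi (a * y) = if inFq n a then q%:Z else 0.
Proof.
case: ifPn => aq.
  rewrite -[RHS]mulr1 -sum_Fq_const; apply: eq_bigr => y yq.
  by move: aq; rewrite chi_mulFq // inFq_trace0 => /eqP ->; rewrite mul0r Tr0 sgnF0.
have [y yq chiy] := chi_neq1 aq.
apply: (@sum_translate_eq0 _ _ y) => x; first exact: inFqDr.
by rewrite mulrDr chiD chiy mulrN1.
Qed.

Lemma sum_Fq_psi (c : F) : inFq n c -> c != 0 ->
  \sum_(y | inFq n y) psi (c * y) = 0.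
Proof.
move=> cq c0; have [y yq psiy] := psi_neq1 cq c0.
rewrite big_mkcond; apply: (@sum_translate_eq0 predT _ y) => // x /=.
rewrite inFqDr //.
by case: ifP => xq; rewrite ?oppr0 // mulrDr psiD ?inFqM // psiy mulrN1.
Qed.

(** The line is a coset of the subfield. For [a] outside the subfield the character is nontrivial
    along it; otherwise [chi (a * t) = psi (a * (t + cj t))] is constant. *)
Lemma sum_trace1_chi (a : F) :
  \sum_(t | t + cj t == 1) chi (a * t) =
  if inFq n a then q%:Z * psi a else 0.
Proof.
have [t /eqP Tt] := exists_rel_trace1.
have trace1D (x y : F) : inFq n y -> (x + y + cj (x + y) == 1) = (x + cj x == 1).
  by move=> /inFqP yq; rewrite cjD yq addrACA addFF addr0.
case: ifPn => aq; last first.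
  have [y yq chiy] := chi_neq1 aq.
  apply: (@sum_translate_eq0 _ _ y) => x; first exact: trace1D.
  by rewrite mulrDr chiD chiy mulrN1.
rewrite -sum_Fq_const (reindex_inj (addrI t)) /=.
apply: eq_big => [y|y].
  by rewrite cjD addrACA (eqP Tt) -subr_eq0 addrAC subrr add0r -inFq_trace0.
by move=> /eqP T1; rewrite Tr_double cjM (inFqP _ aq) -mulrDr T1 mulr1.
Qed.

(** * Sums over the unit circle with [b] on the circle *)

Lemma inU1 : inU n (1 : F).
Proof. by apply/inUP; rewrite cj1 mulr1. Qed.

(* The Moebius map [z = 1 + 1/t] sends the affine line [t + cj t = 1] onto the
   unit circle punctured at [1]. *)
Lemma sum_U_punctured (g : F -> int) :
  \sum_(z | inU n z) g z =
  g 1 + \sum_(t | t + cj t == 1) g (1 + t^-1).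
Proof.
rewrite (bigD1 1) ?inU1 //=; congr (_ + _).
rewrite (reindex (fun t : F => 1 + t^-1)) /=; last first.
  exists (fun z => (1 + z)^-1) => x _; first by rewrite addrA addFF add0r invrK.
  by rewrite invrK addrA addFF add0r.
apply: eq_bigl => t; have [->|t0] := eqVneq t 0.
  by rewrite invr0 addr0 eqxx andbF cj0 addr0 eq_sym oner_eq0.
rewrite -subr_eq0 addrAC subrr add0r invr_eq0 t0 andbT inUE !cjE.
have ct0 : cj t != 0 by rewrite cj_eq0.
rewrite -[LHS]addF_eq0 -[RHS]addF_eq0.
have -> : (1 + t^-1) * (1 + (cj t)^-1) + 1 = (t + cj t + 1) / (t * cj t).
  by field: two_eq0; rewrite ?t0 ?ct0.
by rewrite mulf_eq0 invr_eq0 mulf_eq0 (negPf t0) (negPf ct0) !orbF.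
Qed.

(** The leading 1 is the term [z = 1], where the convention [1/0 = 0] gives [chi 0]; at the other
    points [1 / (z + 1)] is the line parameter [t]. *)
Lemma sum_U_inv1 (a : F) :
  \sum_(z | inU n z) chi (a / (z + 1)) =
  1 + if inFq n a then q%:Z * psi a else 0.
Proof.
rewrite sum_U_punctured addFF invr0 mulr0 Tr0 sgnF0 -sum_trace1_chi.
congr (_ + _); apply: eq_bigr => t _.
by rewrite addrAC addFF add0r invrK.
Qed.

Lemma inUM (x y : F) : inU n x -> inU n y -> inU n (x * y).
Proof. by move=> /inUP xU /inUP yU; apply/inUP; rewrite cjM mulrACA xU yU mulr1. Qed.

Lemma inU_neq0 (x : F) : inU n x -> x != 0.
Proof. by move/inUP; apply: contra_eqN => /eqP ->; rewrite mul0r eq_sym oner_eq0. Qed.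

Lemma inU_cj (x : F) : inU n (cj x) = inU n x.
Proof. by rewrite !inUE cjK mulrC. Qed.

Lemma inU_inv (x : F) : inU n x -> x^-1 = cj x.
Proof.
by move=> xU; apply: (mulfI (inU_neq0 xU)); rewrite (inUP _ xU) divff ?inU_neq0.
Qed.

Lemma sum_U_scale (e : F) (g : F -> int) : inU n e ->
  \sum_(z | inU n z) g (e * z) = \sum_(z | inU n z) g z.
Proof.
move=> eU; rewrite [RHS](reindex_inj (mulfI (inU_neq0 eU))) /=.
apply: eq_bigl => z; apply/idP/idP => zU; first exact: inUM.
by rewrite -(mulKf (inU_neq0 eU) z) inUM // inU_inv // inU_cj.
Qed.

Lemma sum_U_invU (a b : F) : inU n b ->
  \sum_(z | inU n z) chi (a / (z + b)) =
  1 + if inFq n (a * cj b) then q%:Z * psi (a * cj b) else 0.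
Proof.
move=> bU; rewrite -sum_U_inv1 -(sum_U_scale _ bU).
apply: eq_bigr => z _; rewrite -{2}[b]mulr1 -mulrDr invfM (inU_inv bU).
by rewrite mulrA.
Qed.

(** * Unit-circle sums as Kloosterman sums *)

Lemma psi_sqr (x : F) : inFq n x -> psi (x ^+ 2) = psi x.
Proof. by move=> /inFqP xq; rewrite Tr_sqr. Qed.

(* [t * cj t = t ^ 2 + t] on the line [t + cj t = 1]; the fibres have at most
   two elements and lie over trace-one points, and both sides have total
   mass [q], which forces equality. *)
Lemma card_trace1_norm (v : F) : inFq n v ->
  \sum_(t | (t + cj t == 1) && (t * cj t == v)) 1 = 1 - psi v.
Proof.
have line_norm (t : F) : t + cj t == 1 -> t * cj t = t ^+ 2 + t.
  move=> /eqP Tt; have -> : cj t = t + 1 by rewrite -Tt; ring: two_eq0.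
  ring.
pose N w := \sum_(t : F | (t + cj t == 1) && (t * cj t == w)) (1 : int).
have N_le w : inFq n w -> N w <= 1 - psi w.
  move=> wq; rewrite /N.
  case: (pickP [pred t | (t + cj t == 1) && (t * cj t == w)]) => [t|N0]; last first.
    by rewrite big_pred0 //; rewrite /sgnF; case: ifP.
  move=> /= tP; have /andP[Tt /eqP Nt] := tP.
  (* The trace of [t ^ 2 + t] telescopes to [cj t + t = 1]. *)
  have -> : psi w = -1.
    rewrite -Nt line_norm // Tr_artin_schreier [_ + _]addrC (eqP Tt).
    by rewrite /sgnF oner_eq0.
  rewrite (bigD1 t) //= opprK lerD2l.
  case: (pickP [pred x | ((x + cj x == 1) && (x * cj x == w)) && (x != t)])
    => [s|N1]; last by rewrite big_pred0.
  move=> /= sP; rewrite (bigD1 s) //= big_pred0 ?addr0 // => x.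
  apply/negP => /andP[/andP[/andP[Tx /eqP Nx] xt] xs].
  (* Two points of the fibre solve the same equation [Y ^ 2 + Y = w], so they differ by 0 or 1. *)
  have other (y : F) : y + cj y == 1 -> y * cj y = w -> y != t -> y = t + 1.
    move=> Ty Ny yt; move: (Ny); rewrite -Nt !line_norm // => /eqP.
    rewrite -addF_eq0.
    have -> : y ^+ 2 + y + (t ^+ 2 + t) = (y + t) * (y + (t + 1)) by ring: two_eq0.
    by rewrite mulf_eq0 !addF_eq0 (negPf yt) => /eqP.
  have /andP[/andP[Ts /eqP Ns] st] := sP.
  by move: xs; rewrite (other x) // (other s) // eqxx.
have sumN : \sum_(v | inFq n v) N v = q%:Z.
  have := sum_trace1_chi 0; rewrite inFq0 Tr0 sgnF0 mulr1 => <-.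
  rewrite [RHS](partition_big (fun t : F => t * cj t) (inFq n)) => [|t _].
    by apply: eq_bigr => w _; apply: eq_bigr => t _; rewrite mul0r Tr0 sgnF0.
  exact: inFq_rel_norm.
have sum_gap : \sum_(w | inFq n w) (1 - psi w - N w) = 0.
  rewrite !sumrB sumN sum_Fq_const mulr1.
  have := sum_Fq_psi (introT (inFqP 1) cj1) (oner_neq0 F).
  by under eq_bigr do rewrite mul1r; move=> ->; rewrite subr0 subrr.
move=> vq; apply/esym/eqP; rewrite -subr_eq0; apply/eqP.
apply: (psumr_eq0P _ sum_gap) => // w wq.
by rewrite subr_ge0 N_le.
Qed.

Lemma sum_trace1_norm (g : F -> int) :
  \sum_(t | t + cj t == 1) g (t * cj t) =
  \sum_(v | inFq n v) (1 - psi v) * g v.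
Proof.
rewrite (partition_big (fun t : F => t * cj t) (inFq n)) => [|t _] /=; last first.
  exact: inFq_rel_norm.
apply: eq_bigr => v vq; rewrite -card_trace1_norm // mulr_suml.
by apply: eq_bigr => t /andP[_ /eqP ->]; rewrite mul1r.
Qed.

(** Frobenius permutes the subfield and preserves its trace. *)
Lemma kloosterman_sqr (r : F) : inFq n r ->
  kloosterman n (r ^+ 2) = kloosterman n r.
Proof.
move=> rq; have inj_sqr : injective (fun x : F => x ^+ 2).
  by move=> x y /eqP; rewrite eqf_sqr oppr_pchar2 ?pchar2F // orbb => /eqP.
rewrite /kloosterman (reindex_inj inj_sqr) /=.
have sqr_inFq x : inFq n (x ^+ 2 : F) = inFq n x.
  by apply/inFqP/inFqP => [|xq]; rewrite cjX; [exact: inj_sqr | rewrite xq].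
apply: eq_big => x; rewrite sqr_inFq // => xq.
rewrite -[in RHS]psi_sqr; last by rewrite inFqD ?inFqM ?inFqV.
congr (sgnF (Tr 1 n _)); rewrite -exprVn -exprMn; move: (x^-1) => y; ring: two_eq0.
Qed.

Lemma inFq_inv (x : F) : inFq n x^-1 = inFq n x.
Proof. by apply/idP/idP => /inFqV //; rewrite invrK. Qed.

Lemma sum_U_chi_real (r : F) : inFq n r -> r != 0 ->
  \sum_(z | inU n z) chi (r * z) = 1 - kloosterman n r.
Proof.
move=> rq r0; rewrite sum_U_punctured.
have -> : chi (r * 1) = 1.
  by rewrite mulr1 Tr_double (inFqP _ rq) addFF Tr0 sgnF0.
congr (_ + _).
transitivity (\sum_(t : F | t + cj t == 1) psi (r * (t * cj t)^-1)).
  apply: eq_bigr => t /eqP Tt; rewrite Tr_double cjM (inFqP _ rq) -mulrDr !cjE.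
  have t0 : t != 0.
    by apply: contra_eqN Tt => /eqP ->; rewrite cj0 addr0 eq_sym oner_eq0.
  have ct0 : cj t != 0 by rewrite cj_eq0.
  (* The numerator 1 is replaced by [t + cj t], which splits the fraction into [1/t + 1/cj t]. *)
  have -> : (t * cj t)^-1 = (t + cj t) / (t * cj t) by rewrite Tt mul1r.
  by congr (sgnF (Tr 1 n _)); field: two_eq0; rewrite ?t0 ?ct0.
rewrite (sum_trace1_norm (fun v => psi (r * v^-1))).
(* After inversion of [v], the part without [psi v] vanishes by orthogonality; the part with it is
   the Kloosterman sum. *)
under eq_bigr do rewrite mulrBl mul1r.
rewrite sumrB /kloosterman (reindex_inj invr_inj) /=.
under eq_bigl do rewrite inFq_inv.
under eq_bigr do rewrite invrK.
rewrite sum_Fq_psi // sub0r; congr (- _).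
rewrite (reindex_inj invr_inj) /=.
apply: eq_big => v; rewrite inFq_inv // => vq.
by rewrite invrK psiD ?inFqM // inFq_inv.
Qed.

(** A rotation by [c / r], with [r] a square root of the norm of [c], reduces to a coefficient in
    the subfield. *)
Lemma sum_U_chi (c : F) : c != 0 ->
  \sum_(z | inU n z) chi (c * z) = 1 - kloosterman n (c * cj c).
Proof.
(* Raising to the power [2 ^ n.-1] inverts squaring on the subfield. *)
move=> c0; pose r := (c * cj c) ^+ (2 ^ n.-1).
have r2 : r ^+ 2 = c * cj c.
  rewrite -exprM -expnSr prednK //; exact/inFqP/inFq_rel_norm.
have rq : inFq n r by apply/inFqP; rewrite /r cjX !cjE mulrC.
have r0 : r != 0 by rewrite expf_eq0 mulf_eq0 cj_eq0 negb_and negb_or c0 orbT.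
have eU : inU n (c / r).
  by apply/inUP; rewrite cjM cjV (inFqP _ rq) mulrACA -r2; field.
rewrite -r2 kloosterman_sqr // -sum_U_chi_real //.
rewrite -[RHS](sum_U_scale (fun z => chi (r * z)) eU).
by apply: eq_bigr => z _; congr (sgnF (Tr 1 _ _)); field.
Qed.

(* [y = (1 + cj b * z) / (z + b)] permutes the unit circle, and
   [1 / (z + b) = (cj b + y) / (1 + b * cj b)]. *)
Lemma sum_U_inv_notU (a b : F) : a != 0 -> ~~ inU n b ->
  \sum_(z | inU n z) chi (a / (z + b)) =
  chi (cj a * b / (1 + b * cj b)) *
  (1 - kloosterman n (a * cj a / (1 + b ^+ 2 * cj b ^+ 2))).
Proof.
move=> a0 bU; set N := 1 + b * cj b.
have N0 : N != 0 by rewrite addF_eq0 eq_sym -inUE.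
have Nq : cj N = N by rewrite /N !cjE mulrC.
have zb0 z : inU n z -> z + b != 0.
  by move=> zU; rewrite addF_eq0; apply: contraNneq bU => <-.
have -> : 1 + b ^+ 2 * cj b ^+ 2 = N ^+ 2 by rewrite /N; ring: two_eq0.
have -> : a * cj a / N ^+ 2 = (a / N) * cj (a / N).
  by rewrite cjM cjV Nq; field.
rewrite -sum_U_chi; last by rewrite mulf_neq0 ?invr_eq0.
rewrite -(Tr_cj (cj a * b / N)) 2!cjM cjV Nq cjK mulr_sumr.
pose h z := (1 + cj b * z) / (z + b); pose h' y := (1 + b * y) / (y + cj b).
have h_affine z : z + b != 0 -> h z = cj b + N / (z + b).
  move=> zb; rewrite -{1}[cj b](mulfK zb) -mulrDl; congr (_ / _).
  rewrite /N; ring: two_eq0.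
have hK z : z + b != 0 -> h' (h z) = z.
  move=> zb; rewrite /h'.
  have -> : h z + cj b = N / (z + b) by rewrite h_affine // addrC addrA addFF add0r.
  have -> : 1 + b * h z = N * z / (z + b).
    rewrite mulrA -{1}(divff zb) -mulrDl; congr (_ / _); rewrite /N; ring: two_eq0.
  by field; rewrite ?zb ?N0.
have h'K y : inU n y -> h (h' y) = y.
  move=> yU; have yb : y + cj b != 0.
    by rewrite addF_eq0; apply: contraNneq bU => yb; rewrite -inU_cj -yb.
  rewrite /h.
  have -> : h' y + b = N / (y + cj b).
    rewrite -{1}[b](mulfK yb) -mulrDl; congr (_ / _); rewrite /N; ring: two_eq0.
  have -> : 1 + cj b * h' y = N * y / (y + cj b).
    rewrite mulrA -{1}(divff yb) -mulrDl; congr (_ / _); rewrite /N; ring: two_eq0.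
  by field; rewrite ?yb ?N0.
have hU z : z + b != 0 -> inU n (h z) = inU n z.
  move=> zb; have czb : cj z + cj b != 0 by rewrite -cjD cj_eq0.
  rewrite !inUE /h !cjE -[LHS]addF_eq0 -[RHS]addF_eq0.
  have -> : (1 + cj b * z) / (z + b) * ((1 + b * cj z) / (cj z + cj b)) + 1 =
      N * (z * cj z + 1) / ((z + b) * (cj z + cj b)).
    rewrite mulf_div -{3}(divff (mulf_neq0 zb czb)) -mulrDl; congr (_ / _).
    rewrite /N; ring: two_eq0.
  by rewrite !mulf_eq0 invr_eq0 mulf_eq0 (negPf N0) (negPf zb) (negPf czb) !orbF.
rewrite [RHS](reindex_onto h h') //=; apply: eq_big => [z|z zU].
  (* At the pole [z = b] the convention [1/0 = 0] gives [h b = 0]. Neither [b] nor 0 is on the unit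
     circle, so both index conditions fail there. *)
  have [zb|zb] := eqVneq (z + b) 0; last by rewrite hU // hK // eqxx andbT.
  move/eqP: zb; rewrite addF_eq0 => /eqP ->; rewrite (negPf bU) /h addFF invr0 mulr0.
  by rewrite inUE mul0r eq_sym oner_eq0.
rewrite -chiD h_affine ?zb0 //; congr (sgnF (Tr 1 _ _)).
by rewrite mulrDr addrA [a / N * cj b]mulrAC addFF add0r mulrA divfK.
Qed.

(** * Signs and majority for the case analysis *)

Lemma inU_inFq (b : F) : inU n b -> inFq n b -> b = 1.
Proof.
move=> /inUP bU /inFqP bq; apply/eqP.
by rewrite -addF_eq0 -sqrf_eq0 -(expn1 2) exp2kD expn1 expr1n expr2 -{2}bq bU addFF.
Qed.

(** The square of [a * cj b] is the norm of [a], and [psi] is invariant under squaring; this brings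
    in the norms in the trace conditions. *)
Lemma psi_unit_circle (a b : F) : inU n b -> inFq n (a * cj b) ->
  psi (a * cj b) = psi (a * cj a).
Proof.
move=> bU abq; rewrite -psi_sqr // expr2 -{2}(inFqP _ abq) cjM cjK.
by rewrite mulrACA [cj b * b]mulrC (inUP _ bU) mulr1.
Qed.

Lemma Tr_inFq (a : F) : inFq n a -> Tr 1 (2 * n) a = 0.
Proof. by rewrite inFq_trace0 Tr_double => /eqP ->; rewrite Tr0. Qed.

Lemma sgnF_opp (x y : F) : sgnF x * sgnF y = -1 -> sgnF x = - sgnF y.
Proof. by rewrite /sgnF; do 2 case: (_ == 0). Qed.

(** This is [h3] read in the variable [z = x ^ (q - 1)]; on bits the symmetric polynomial is the
    majority function. *)
Definition maj_inv (a1 a2 a3 b z : F) :=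
  let f a := Tr 1 (2 * n) (a / (z + b)) in
  f a1 * f a2 + f a1 * f a3 + f a2 * f a3.

Lemma sum_U_maj_inv (a1 a2 a3 b : F) :
  let S a := \sum_(z | inU n z) chi (a / (z + b)) in
  2 * \sum_(z | inU n z) sgnF (maj_inv a1 a2 a3 b z) =
  S a1 + S a2 + S a3 - S (a1 + a2 + a3).
Proof.
rewrite /= mulr_sumr -!big_split -sumrB; apply: eq_bigr => z _ /=.
by rewrite sgnF_majority ?mulrDl ?TrD //; apply/Tr_bool/exp_card2.
Qed.

(** * Polar decomposition and bent functions *)

Lemma sum_Fq_unit_const (c : int) :
  \sum_(y : F | inFq n y && (y != 0)) c = (q%:Z - 1) * c.
Proof.
rewrite mulrBl mul1r -sum_Fq_const [X in X - _](bigD1 0) ?inFq0 //=.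
by rewrite addrAC subrr add0r.
Qed.

Lemma exp_unit_Fq (y : F) : inFq n y -> y != 0 -> y ^+ (q - 1) = 1.
Proof.
move=> /inFqP yq y0; apply: (mulfI y0).
by rewrite -exprS subn1 prednK ?expn_gt0 // mulr1.
Qed.

Lemma exp_polar (x : F) : x != 0 -> x ^+ (q - 1) = cj x / x.
Proof.
move=> x0; apply: (mulIf x0).
by rewrite -exprSr subn1 prednK ?expn_gt0 // divfK.
Qed.

Lemma exp_polar_inU (x : F) : x != 0 -> inU n (x ^+ (q - 1)).
Proof.
move=> x0; have cx0 : cj x != 0 by rewrite cj_eq0.
by apply/inUP; rewrite exp_polar // !cjE; field; rewrite ?x0 ?cx0.
Qed.

(** Hilbert 90 with an explicit witness: since [cj z = 1/z], the ratio [cj t / t] for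
    [t = (z + 1)^-1] is [z]. The point [z = 1], where this [t] degenerates to 0, is treated
    apart. *)
Lemma exp_polar_surj (z : F) : inU n z -> exists2 t, t != 0 & t ^+ (q - 1) = z.
Proof.
move=> zU; have [->|z1] := eqVneq z 1.
  by exists 1; rewrite ?oner_eq0 ?expr1n.
have z0 := inU_neq0 zU; have z10 : z + 1 != 0 by rewrite addF_eq0.
exists (z + 1)^-1; first by rewrite invr_eq0.
rewrite exp_polar ?invr_eq0 // !cjE -(inU_inv zU).
have z11 : z^-1 + 1 != 0.
  by have := cj_eq0 (z + 1); rewrite !cjE -(inU_inv zU) (negPf z10) => ->.
have -> : z^-1 + 1 = (z + 1) / z by field.
by field; rewrite z0 z10 oner_eq0.
Qed.

(** Each fibre over the unit circle is a coset of the [q - 1] nonzero subfield elements; the term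
    [g 0] comes from [x = 0]. *)
Lemma sum_polar (g : F -> int) :
  \sum_x g (x ^+ (q - 1)) = g 0 + (q%:Z - 1) * \sum_(z | inU n z) g z.
Proof.
have q1 : (0 < q - 1)%N by rewrite subn_gt0 -{1}(expn0 2) ltn_exp2l.
rewrite (bigD1 0) //= expr0n eqn0Ngt q1; congr (_ + _).
rewrite (partition_big (fun x : F => x ^+ (q - 1)) (inU n)) => [|x x0] /=; last first.
  exact: exp_polar_inU.
rewrite mulr_sumr; apply: eq_bigr => z zU.
have [t t0 tz] := exp_polar_surj zU.
rewrite -sum_Fq_unit_const (reindex_inj (mulfI t0)) /=.
apply: eq_big => [y|y /andP[_ /eqP ->] //].
rewrite mulf_eq0 negb_or t0 /= exprMn tz.
have [//|y0] /= := eqVneq y 0; first by rewrite andbF.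
rewrite andbT -{2}[z]mulr1 (inj_eq (mulfI (inU_neq0 zU))) exp_polar //.
by rewrite -(inj_eq (mulIf y0)) divfK // mul1r.
Qed.

(** The Walsh value at [w] turns out to be [q * s w^-1], where [w^-1] is 0 for [w = 0]. The
    hypothesis makes the total sum of [s] equal to [q * s 0]. *)
Lemma bent_polar (g : F -> F) :
    \sum_(z | inU n z) sgnF (g z) = sgnF (g 0) ->
  bent (2 * n) (fun x => g (x ^+ (q - 1)) != 0).
Proof.
move=> sumU w; pose s x := sgnF (g (x ^+ (q - 1))).
have q1 : (0 < q - 1)%N by rewrite subn_gt0 -{1}(expn0 2) ltn_exp2l.
have s0 : s 0 = sgnF (g 0) by rewrite /s expr0n eqn0Ngt q1.
have sum_s : \sum_x s x = q%:Z * s 0.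
  by rewrite (sum_polar (fun z => sgnF (g z))) sumU s0; ring.
have s_scale x y : inFq n y -> y != 0 -> s (x * y) = s x.
  by move=> yq y0; rewrite /s exprMn (exp_unit_Fq yq y0) mulr1.
have walshE : walsh (2 * n) (fun x => g (x ^+ (q - 1)) != 0) w =
    \sum_x s x * chi (w * x).
  apply: eq_bigr => x _; rewrite signr_addb /s /sgnF.
  by do 2 case: (_ == 0).
rewrite walshE; set W := \sum_x _.
suff [x ->] : exists x, W = q%:Z * s x.
  by rewrite exprMn sgnF_sqr mulr1 expr2 -PoszM mulnn -expnM mulnC.
have [w0|w0] := eqVneq w 0.
  exists 0; rewrite -sum_s; apply: eq_bigr => x _.
  by rewrite w0 mul0r Tr0 sgnF0 mulr1.
exists w^-1.
have q10 : q%:Z - 1 != 0.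
  by rewrite subr_eq0 eqz_nat; move: q1; case: (q) => [|[]].
apply: (mulfI q10); apply: (addrI (q%:Z * s 0)).
(* double counting of [s x * chi (w * x * y)] over [x] and [y] in [F_q] *)
transitivity (\sum_(y | inFq n y) \sum_x s x * chi (w * x * y)).
  rewrite (bigD1 0) ?inFq0 //=; congr (_ + _).
    by rewrite -sum_s; apply: eq_bigr => x _; rewrite mulr0 Tr0 sgnF0 mulr1.
  rewrite -sum_Fq_unit_const; apply: eq_bigr => y /andP[yq y0].
  rewrite /W (reindex_inj (mulIf y0)) /=; apply: eq_bigr => x _.
  by rewrite s_scale // mulrA.
(* Summing over [y] first leaves only the [x] with [w * x] in the subfield: 0 and one punctured
   line, on which [s] is constant. *)
rewrite exchange_big /=.
under eq_bigr do rewrite -mulr_sumr sum_Fq_chi.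
rewrite (reindex_inj (mulfI (invr_neq0 w0))) /=.
transitivity (\sum_(y | inFq n y) s (w^-1 * y) * q%:Z).
  rewrite [RHS]big_mkcond; apply: eq_bigr => y _.
  by rewrite mulVKf //; case: ifP; rewrite ?mulr0.
rewrite (bigD1 0) ?inFq0 //= mulr0 mulrC; congr (_ + _).
transitivity (\sum_(y : F | inFq n y && (y != 0)) s w^-1 * q%:Z).
  by apply: eq_bigr => y /andP[yq y0]; rewrite s_scale.
by rewrite sum_Fq_unit_const; ring.
Qed.

End QuadraticExtension.

(** * The six families of parameters *)

Theorem theorem3 (F : finFieldType) (n : nat) (hF : #|F| = (2 ^ (2 * n))%N)
  (hn : (2 < n)%N) (a1 a2 a3 b : F)
  (ha1q : inFq n a1) (ha1 : a1 != 0) (ha2 : a2 != 0) (ha3 : a3 != 0)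
  (h12 : a1 != a2) (h13 : a1 != a3) (h23 : a2 != a3)
  (hs : a1 + a2 + a3 != 0) (hb : b != 0) :
  let q := (2 ^ n)%N in
  let f := fun (a x : F) => Tr 1 (2 * n) (a / (x ^+ (q - 1) + b)) in
  let h3 := fun x : F => f a1 x * f a2 x + f a1 x * f a3 x + f a2 x * f a3 x in
  let k := fun x : F =>
    kloosterman n (x * conjq n x / (1 + b ^+ 2 * conjq n b ^+ 2)) in
  let u := fun x : F => Tr 1 (2 * n) (conjq n x * b / (1 + b * conjq n b)) in
  let s := a1 + a2 + a3 in
  ( (b = 1 /\ inFq n a2 /\ ~~ inFq n a3 /\ Tr 1 n (a1 + a2) = 1)
  \/ (b = 1 /\ ~~ inFq n a2 /\ ~~ inFq n a3 /\ inFq n (a2 + a3) /\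
      Tr 1 n (a2 + a3) = 0 /\ Tr 1 (2 * n) a2 = 0)
  \/ (inU n b /\ b != 1 /\ Tr n (2 * n) (a2 * conjq n b) = 0 /\
      Tr n (2 * n) (a3 * conjq n b) = 0 /\
      Tr 1 n (a2 * conjq n a2 + a3 * conjq n a3) = 1 /\ h3 0 = 0)
  \/ (inU n b /\ b != 1 /\ Tr n (2 * n) (a2 * conjq n b) = 0 /\
      Tr n (2 * n) (a3 * conjq n b) != 0 /\
      Tr n (2 * n) (s * conjq n b) = 0 /\
      Tr 1 n (a2 * conjq n a2) =
        Tr 1 n (s * (a1 + conjq n a2 + conjq n a3)) /\ h3 0 = 0)
  \/ (inU n b /\ b != 1 /\ Tr n (2 * n) (a2 * conjq n b) != 0 /\
      Tr n (2 * n) (a3 * conjq n b) != 0 /\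
      Tr n (2 * n) (s * conjq n b) != 0 /\ h3 0 = 0)
  \/ (~~ inU n b /\
      2 * sgnF (h3 0) =
        2 * sgnF (u a1 * u a2 + u a1 * u a3 + u a2 * u a3)
        + sgnF (u s) * k s
        - (sgnF (u a1) * k a1 + sgnF (u a2) * k a2 + sgnF (u a3) * k a3)) ) ->
  bent (2 * n) (fun x => h3 x != 0).
Proof.
move=> q f h3 k u s cases.
have n_gt0 : (0 < n)%N by apply: leq_trans hn.
have q1 : (0 < q - 1)%N by rewrite subn_gt0 -{1}(expn0 2) ltn_exp2l.
pose G := maj_inv n a1 a2 a3 b.
have h3_0 : h3 0 = G 0 by rewrite /h3 /f expr0n eqn0Ngt q1.
apply: (bent_polar hF n_gt0 (g := G)); rewrite -h3_0.
have two0 : 2 != 0 :> int by [].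
apply: (mulfI two0); rewrite sum_U_maj_inv // -/s.
have qS := sum_U_invU hF n_gt0.
(* If [a1 * cj b] were in the subfield, so would be [b]; but the circle meets the subfield only in
   1. *)
have a1b : inU n b -> b != 1 -> inFq n (a1 * conjq n b) = false.
  move=> bU; apply: contraNF => a1b; apply/eqP/(inU_inFq hF bU).
  have := inFqM (inFqV ha1q) a1b; rewrite mulKf // => /inFqP.
  by rewrite cjK // => cjb; apply/inFqP/esym.
case: cases => [|[|[|[|[|]]]]].
(* Only [a1] and [a2] give terms of size [q], with opposite signs; the constants [1 + 1 + 1 - 1]
   give 2. *)
- move=> [b1 [a2q [a3q psi12]]].
  have sq : inFq n s = false.
    by rewrite /s addrC inFqDr ?(negPf a3q) // inFqD.
  have psi2 : sgnF (Tr 1 n a1) = - sgnF (Tr 1 n a2).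
    by apply: sgnF_opp; rewrite -psiD // psi12 /sgnF oner_eq0.
  have -> : h3 0 = 0.
    by rewrite h3_0 /G /maj_inv add0r b1 invr1 !mulr1 !(Tr_inFq _ ha1q) //
      !(Tr_inFq _ a2q) // !mul0r !addr0.
  by rewrite b1 !sum_U_inv1 // ha1q a2q sq (negPf a3q) psi2 sgnF0; ring.
(* Only [a1] and the sum [s] give terms of size [q]; they are equal and enter with opposite
   signs. *)
- move=> [b1 [a2q [a3q [a23q [Tr23 Tr2]]]]].
  have sq : inFq n s by rewrite /s -addrA inFqD.
  have psis : sgnF (Tr 1 n s) = sgnF (Tr 1 n a1).
    by rewrite /s -addrA psiD // Tr23 sgnF0 mulr1.
  have -> : h3 0 = 0.
    by rewrite h3_0 /G /maj_inv add0r b1 invr1 !mulr1 Tr2 !(Tr_inFq _ ha1q) //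
      !mul0r !addr0.
  by rewrite b1 !sum_U_inv1 // ha1q (negPf a2q) (negPf a3q) sq psis sgnF0; ring.
(* The terms of [a2] and [a3] cancel. *)
- move=> [bU [b1 [/eqP T2 [/eqP T3 [psi23 ->]]]]].
  rewrite -inFq_Tr_rel // in T2; rewrite -inFq_Tr_rel // in T3.
  have sq : inFq n (s * conjq n b) = false.
    by rewrite /s -addrA mulrDl inFqDr ?a1b // mulrDl inFqD.
  have psi2 : sgnF (Tr 1 n (a2 * conjq n a2)) = - sgnF (Tr 1 n (a3 * conjq n a3)).
    by apply: sgnF_opp; rewrite -psiD ?inFq_rel_norm // psi23 /sgnF oner_eq0.
  by rewrite !qS // a1b // sq T2 T3 !psi_unit_circle // psi2 sgnF0; ring.
(* The terms of [a2] and [s] cancel. *)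
- move=> [bU [b1 [/eqP T2 [T3 [/eqP Ts [psi2s ->]]]]]].
  rewrite -inFq_Tr_rel // in T2; rewrite -inFq_Tr_rel // in T3.
  rewrite -inFq_Tr_rel // in Ts.
  have {}psi2s : Tr 1 n (a2 * conjq n a2) = Tr 1 n (s * conjq n s).
    by rewrite psi2s /s !cjD // (inFqP _ _ ha1q).
  rewrite !qS // a1b // T2 (negPf T3) Ts !psi_unit_circle // psi2s sgnF0; ring.
(* No term of size [q] occurs. *)
- move=> [bU [b1 [T2 [T3 [Ts ->]]]]].
  rewrite -inFq_Tr_rel // in T2; rewrite -inFq_Tr_rel // in T3.
  rewrite -inFq_Tr_rel // in Ts.
  by rewrite !qS // a1b // (negPf T2) (negPf T3) (negPf Ts) sgnF0; ring.
(* As [u] is additive, the majority identity also recombines the signs of the [u] values; what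
   remains is the Kloosterman part of the hypothesis. *)
- move=> [bU ->]; rewrite !sum_U_inv_notU //.
  have us : u s = u a1 + u a2 + u a3 by rewrite /u /s !(cjD hF) !mulrDl !(TrD hF).
  rewrite (sgnF_majority hF) -?us; try exact/(Tr_bool hF)/(exp_card2 hF).
  rewrite -/(u a1) -/(u a2) -/(u a3) -/(u s) -/(k a1) -/(k a2) -/(k a3) -/(k s).
  ring.
Qed.
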